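(* Let $\varphi=\frac{1+\sqrt5}{2}$. For every real number $x$ such that $1<x<2$ and every integer $N\ge2$, $$\bigl|[q^N]\,[x]_q\bigr|\le\bigl|[q^N]\,[\varphi]_q\bigr| .$$
   Context: $[q^N]A$ denotes the coefficient of $q^N$ in a formal power series $A\in\mathbb{Z}[[q]]$. For an integer $a$ put $[a]_q=\frac{1-q^a}{1-q}$ (so $[a]_q=1+q+\cdots+q^{a-1}$ for $a\ge1$, and $[0]_q=0$). Definition of the $q$-real $[x]_q$. Every real $x$ has a unique negative (Hirzebruch) continued fraction expansion with $a_1\in\mathbb{Z}$ and $a_i\ge2$ integers for $i\ge2$: if $x$ is rational it is finite, $x=a_1-\cfrac{1}{a_2-\cfrac{1}{\ddots-\cfrac{1}{a_k}}}$, written $x=[\![a_1,\dots,a_k]\!]$, and if $x$ is irrational it is infinite, $x=[\![a_1,a_2,a_3,\dots]\!]$. For rational $x=[\![a_1,\dots,a_k]\!]$ one sets $$[x]_q=[a_1]_q-\cfrac{q^{a_1-1}}{[a_2]_q-\cfrac{q^{a_2-1}}{\ddots-\cfrac{q^{a_{k-1}-1}}{[a_k]_q}}},$$ a rational function of $q$, identified with its Laurent expansion at $q=0$. For irrational $x=[\![a_1,a_2,\dots]\!]$, each coefficient of the Laurent expansions at $q=0$ of $\big[[\![a_1,\dots,a_k]\!]\big]_q$ stabilizes as $k\to\infty$ (known stabilization theorem), and $[x]_q\in\mathbb{Z}((q))$ is defined as the resulting limit. For $x\ge0$ one has $[x]_q\in\mathbb{Z}[[q]]$. *)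

(* Defs.v *)
From HB Require Import structures.
From mathcomp Require Import all_boot all_order all_algebra fraction.
From mathcomp Require Import all_classical all_reals all_analysis.

Set Implicit Arguments.
Unset Strict Implicit.
Unset Printing Implicit Defensive.

Import Order.TTheory GRing.Theory Num.Theory.
Import numFieldNormedType.Exports.

Local Open Scope classical_set_scope.
Local Open Scope ring_scope.

(** Negative (Hirzebruch) continued fractions.  A nonempty digit sequence
    [a_1, ..., a_k] is given by its head [a = a_1] and its tail
    [s = [:: a_2; ...; a_k]]. *)

Fixpoint hcf (R : realType) (a : int) (s : seq int) : R :=
  if s is b :: s' then a%:~R - (hcf R b s')^-1 else a%:~R.

(** An infinite digit sequence [a_1, a_2, ...] is a function [a : nat -> int]
    with [a i = a_(i+1)]; this is the tail [:: a_2; ...; a_(k+1)]. *)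
Definition htail (a : nat -> int) (k : nat) : seq int :=
  [seq a i | i <- iota 1 k].

Definition finite_hexp (R : realType) (x : R) (a : int) (s : seq int) : Prop :=
  all (fun b => 2 <= b) s /\ x = hcf R a s.

Definition infinite_hexp (R : realType) (x : R) (a : nat -> int) : Prop :=
  (forall i : nat, (0 < i)%N -> 2 <= a i) /\
  (hcf R (a 0%N) (htail a k) @[k --> \oo] --> x).

Definition irrational (R : realType) (x : R) : Prop :=
  forall r : rat, x <> ratr r.

(** Rational functions of [q], as fractions of integer polynomials. *)

Notation ratfun := {fraction {poly int}}.

Definition q : ratfun := tofrac 'X.

Definition qint (a : int) : ratfun := (1 - q ^ a) / (1 - q).

Fixpoint qhcf (a : int) (s : seq int) : ratfun :=
  if s is b :: s' then qint a - q ^ (a - 1) / qhcf b s' else qint a.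

(** Laurent series with integer coefficients, i.e. elements of Z((q)):
    [A n] is the coefficient of [q^n], for [n : int]. *)

Definition is_laurent (A : int -> int) : Prop :=
  exists m : int, forall n : int, n < m -> A n = 0.

Definition laurent_of_poly (p : {poly int}) (n : int) : int :=
  if n is Posz i then p`_i else 0.

Definition laurent_mulp (p : {poly int}) (A : int -> int) (n : int) : int :=
  \sum_(i < size p) p`_i * A (n - i%:Z).

(** [A] is the Laurent expansion at [q = 0] of [f = u / v] when [v A = u]
    in Z((q)). *)
Definition laurent_expansion (f : ratfun) (A : int -> int) : Prop :=
  is_laurent A /\
  exists u v : {poly int},
    [/\ v != 0, f = tofrac u / tofrac v &
        laurent_mulp v A =1 laurent_of_poly u].

(** Coefficientwise stabilization of the expansions of the rational
    functions [f k] to [A]. *)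
Definition laurent_stabilizes (f : nat -> ratfun) (A : int -> int) : Prop :=
  is_laurent A /\
  exists B : nat -> int -> int,
    (forall k, laurent_expansion (f k) (B k)) /\
    (forall n : int, exists K : nat, forall k, (K <= k)%N -> B k n = A n).

Definition is_qreal (R : realType) (x : R) (A : int -> int) : Prop :=
  (exists a s, finite_hexp x a s /\ laurent_expansion (qhcf a s) A) \/
  (irrational x /\
   exists a, infinite_hexp x a /\
     laurent_stabilizes (fun k => qhcf (a 0%N) (htail a k)) A).

(** The q-deformation of [x]: the unique [A] with [is_qreal x A]. The default
    value of [xget] plays no role, since such an [A] always exists. *)
Definition qreal (R : realType) (x : R) : int -> int :=
  xget (fun=> 0) [set A | is_qreal x A].

Definition golden (R : realType) : R := (1 + Num.sqrt 5) / 2.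

(* Main.v *)
Require Import Defs.
From HB Require Import structures.
From mathcomp Require Import all_boot all_order all_algebra fraction.
From mathcomp Require Import all_classical all_reals all_analysis.
From mathcomp Require Import ring lra zify.

(** For [y > 1] write [1 + W] for the inverse of the q-real of [y].  The q-real of
    [x = 2 - 1/y] is [1 + q - q (1 + W)], so beyond [q] its coefficients are those
    of [W], up to sign and a shift by one.  Split the digits of [y] into [j - 1]
    twos, a digit [m + 2 >= 3], and a tail with series [V]; then
    [W = q^(j-1) D / (1 - [j]_q D)] with [D = - q ([m]_q - q^m V)].  For the golden
    ratio all blocks have [j = m = 1], and [W(-q)] is the solution [w], with
    nonnegative coefficients, of [w = q + q w + q^2 w + q^2 w^2].  If [w] dominates
    the absolute values of the coefficients of [V], it also dominates those of
    [W]: in each of the cases [j = 1], [j >= 2] and [m = 1], [m >= 2] the relation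
    can be rewritten as [W = a + q b W] with so few terms that, [a'] and [b'] being
    [a] and [b] with absolute values taken, [a' + q b' w <= w] coefficientwise; an
    induction on the coefficients concludes. *)

Import Order.TTheory GRing.Theory Num.Theory.
Import numFieldNormedType.Exports.
Local Open Scope ring_scope.

Set Implicit Arguments.
Unset Strict Implicit.
Unset Printing Implicit Defensive.

(** * Formal power series *)

Definition fps (R : Type) := nat -> R.

Section FormalPowerSeries.
Variable R : comNzRingType.
Implicit Types f g h : fps R.

HB.instance Definition _ := gen_eqMixin (fps R).
HB.instance Definition _ := gen_choiceMixin (fps R).

Definition fps_add f g : fps R := fun n => f n + g n.
Definition fps_opp f : fps R := fun n => - f n.
Definition fps_zero : fps R := fun=> 0.
Definition fps_one : fps R := fun n => (n == 0%N)%:R.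
Definition fps_mul f g : fps R := fun n => \sum_(i < n.+1) f i * g (n - i)%N.

Fact fps_addA : associative fps_add.
Proof. by move=> f g h; apply/funext => n; exact: addrA. Qed.
Fact fps_addC : commutative fps_add.
Proof. by move=> f g; apply/funext => n; exact: addrC. Qed.
Fact fps_add0 : left_id fps_zero fps_add.
Proof. by move=> f; apply/funext => n; exact: add0r. Qed.
Fact fps_addN : left_inverse fps_zero fps_opp fps_add.
Proof. by move=> f; apply/funext => n; exact: addNr. Qed.

HB.instance Definition _ :=
  GRing.isZmodule.Build (fps R) fps_addA fps_addC fps_add0 fps_addN.

Definition fps_trunc n f : {poly R} := \poly_(i < n) f i.

(** A coefficient of a product involves no later coefficients of the factors, so the ring laws can
    be taken over from [{poly R}]. *)
Fact fps_mul_trunc n i f g : (i < n)%N ->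
  fps_mul f g i = (fps_trunc n f * fps_trunc n g)`_i.
Proof.
move=> lt_in; rewrite coefM; apply: eq_bigr => j _.
have lt_jn : (j < n)%N by exact: leq_ltn_trans (leq_ord j) lt_in.
by rewrite !coef_poly lt_jn (leq_ltn_trans (leq_subr _ _) lt_in).
Qed.

Fact fps_mulC : commutative fps_mul.
Proof.
by move=> f g; apply/funext => n; rewrite !(@fps_mul_trunc n.+1)// mulrC.
Qed.

Fact fps_mulA : associative fps_mul.
Proof.
move=> f g h; apply/funext => n.
have coef_trunc (u : {poly R}) k : (k < n.+1)%N -> forall v : {poly R},
    (forall i, (i < n.+1)%N -> u`_i = v`_i) -> u`_k = v`_k by move=> ? ? ->.
rewrite !(@fps_mul_trunc n.+1)//.
transitivity (fps_trunc n.+1 f * fps_trunc n.+1 g * fps_trunc n.+1 h)`_n.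
  rewrite -mulrA !coefM; apply: eq_bigr => i _; congr (_ * _).
  have lt_i : (n - i < n.+1)%N by rewrite ltnS leq_subr.
  by rewrite {1}/fps_trunc coef_poly lt_i (@fps_mul_trunc n.+1).
rewrite !coefM; apply: eq_bigr => i _; congr (_ * _).
by rewrite [RHS]coef_poly ltn_ord (@fps_mul_trunc n.+1).
Qed.

Fact fps_mul1 : left_id fps_one fps_mul.
Proof.
move=> f; apply/funext => n; rewrite /fps_mul big_ord_recl subn0 mul1r.
by rewrite big1 ?addr0// => i _; rewrite mul0r.
Qed.

Fact fps_mulDl : left_distributive fps_mul fps_add.
Proof.
move=> f g h; apply/funext => n; rewrite /fps_mul/fps_add -big_split/=.
by apply: eq_bigr => i _; rewrite mulrDl.
Qed.

Fact fps_oner_neq0 : fps_one != fps_zero.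
Proof.
by apply/eqP => /(congr1 (fun f : fps R => f 0%N)) /eqP; rewrite oner_eq0.
Qed.

HB.instance Definition _ := GRing.Zmodule_isComNzRing.Build (fps R)
  fps_mulA fps_mulC fps_mul1 fps_mulDl fps_oner_neq0.

Lemma fpsP f g : f =1 g -> f = g. Proof. by move/funext. Qed.

Lemma coef_fpsD f g n : (f + g) n = f n + g n. Proof. by []. Qed.

Lemma coef_fpsN f n : (- f) n = - f n. Proof. by []. Qed.

Lemma coef_fpsB f g n : (f - g) n = f n - g n. Proof. by []. Qed.

Lemma coef_fps1 n : (1 : fps R) n = (n == 0%N)%:R. Proof. by []. Qed.

Lemma coef_fpsM f g n : (f * g) n = \sum_(i < n.+1) f i * g (n - i)%N.
Proof. by []. Qed.

Lemma coef0_fpsM f g : (f * g) 0%N = f 0%N * g 0%N.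
Proof. by rewrite coef_fpsM big_ord1. Qed.

Definition fpsX : fps R := fun n => (n == 1%N)%:R.

Lemma coef_fpsXM f n : (fpsX * f) n = if n is n'.+1 then f n' else 0.
Proof.
rewrite coef_fpsM big_ord_recl mul0r add0r; case: n => [|n].
  by rewrite big_ord0.
rewrite big_ord_recl mul1r big1 ?addr0 => [|i _]; last by rewrite mul0r.
by rewrite /bump /= subSS subn0.
Qed.

Lemma coef_fpsXnM k f n :
  (fpsX ^+ k * f) n = if (k <= n)%N then f (n - k)%N else 0.
Proof.
elim: k n => [|k IHk] n; first by rewrite mul1r subn0.
by rewrite exprS -mulrA coef_fpsXM; case: n => [|n]; rewrite ?IHk.
Qed.

Lemma fpsX_decomp f : f 0%N = 0 -> exists g, f = fpsX * g.
Proof.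
move=> f0; exists (fun n => f n.+1); apply: fpsP => -[|n].
  by rewrite coef_fpsXM.
by rewrite coef_fpsXM.
Qed.

(** Geometric series: for [f = 1 - X x], the coefficient at [n] of the partial sums of the powers of
    [X x] is constant beyond [n] terms, and these constants form the inverse. *)
Lemma fps_inv_ex f : f 0%N = 1 -> exists g, f * g = 1 /\ g 0%N = 1.
Proof.
move=> f0; have [|x eq_x] := @fpsX_decomp (1 - f).
  by rewrite coef_fpsB f0 subrr.
have -> : f = 1 - fpsX * x by rewrite -eq_x; ring.
pose part n := \sum_(i < n) (fpsX * x) ^+ i.
have partE n : (1 - fpsX * x) * part n = 1 - (fpsX * x) ^+ n.
  by rewrite -[RHS]opprB subrX1 -[RHS]mulNr opprB.
have coef_part n k : (n < k)%N -> part k n = part n.+1 n.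
  elim: k => // k IHk; rewrite ltnS leq_eqVlt => /predU1P[->//|lt_nk].
  rewrite -IHk// /part big_ord_recr/= coef_fpsD exprMn.
  by rewrite coef_fpsXnM leqNgt lt_nk addr0.
exists (fun n => part n.+1 n); split; last first.
  by rewrite /part big_ord1 expr0.
apply: fpsP => n; transitivity (((1 - fpsX * x) * part n.+1) n).
  rewrite !coef_fpsM; apply: eq_bigr => i _; congr (_ * _).
  by rewrite [RHS]coef_part// ltnS leq_subr.
by rewrite partE coef_fpsB exprMn coef_fpsXnM ltnn subr0.
Qed.

Definition fps_of_poly (p : {poly R}) : fps R := fun n => p`_n.

Fact fps_of_poly_zmod_morphism : zmod_morphism fps_of_poly.
Proof. by move=> p r; apply: fpsP => n; rewrite /fps_of_poly coefB. Qed.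

Fact fps_of_poly_monoid_morphism : monoid_morphism fps_of_poly.
Proof.
split; first by apply: fpsP => n; rewrite /fps_of_poly coef1.
by move=> p r; apply: fpsP => n; rewrite /fps_of_poly coefM.
Qed.

HB.instance Definition _ := GRing.isZmodMorphism.Build {poly R} (fps R)
  fps_of_poly fps_of_poly_zmod_morphism.
HB.instance Definition _ := GRing.isMonoidMorphism.Build {poly R} (fps R)
  fps_of_poly fps_of_poly_monoid_morphism.

Lemma fps_of_polyX : fps_of_poly 'X = fpsX.
Proof. by apply: fpsP => n; rewrite /fps_of_poly coefX. Qed.

End FormalPowerSeries.

Arguments fpsX {R}.

Lemma fps_cancel (R : comNzRingType) (c f g : fps R) :
  c 0%N = 1 -> c * f = c * g -> f = g.
Proof.
move=> /fps_inv_ex[d [cd1 _]] eq_cf.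
by rewrite -[f]mul1r -[g]mul1r -cd1 ![_ * d]mulrC -!mulrA eq_cf.
Qed.

(** The lowest nonzero coefficients of two nonzero factors, at [i] and [j], give a nonzero
    coefficient of the product at [i + j]. *)
Lemma fps_mulf_eq0 (R : idomainType) (f g : fps R) :
  f * g = 0 -> f <> 0 -> g = 0.
Proof.
move=> fg0 fn0; apply: fpsP => n; apply/eqP; apply: contrapT => /negP gn.
have exf : exists i, f i != 0.
  apply: contrapT => nf; apply: fn0; apply: fpsP => i; apply/eqP.
  by apply: contrapT => /negP fi; apply: nf; exists i.
have exg : exists j, g j != 0 by exists n.
case: (ex_minnP exf) => i fi min_i; case: (ex_minnP exg) => j gj min_j.
have /eqP := congr1 (fun h : fps R => h (i + j)%N) fg0.
have lt_i : (i < (i + j).+1)%N by rewrite ltnS leq_addr.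
rewrite coef_fpsM (bigD1 (Ordinal lt_i))//= addKn big1 => [|k /eqP neq_ki].
  by rewrite addr0 mulf_eq0 (negbTE fi) (negbTE gj).
have [lt_ki|le_ik] := ltnP k i.
  have [->|/min_i] := eqVneq (f k) 0; first by rewrite mul0r.
  by rewrite leqNgt lt_ki.
have [->|/min_j] := eqVneq (g (i + j - k)%N) 0; first by rewrite mulr0.
have neq : nat_of_ord k <> i by move=> eq_ki; apply: neq_ki; apply: val_inj.
have := ltn_ord k; lia.
Qed.

Local Notation series := (fps int).
(* The instance is spelled out so that [ring] meets a single form of [X]. *)
Local Notation X := (@fpsX ssrint_int__canonical__GRing_ComNzRing).
Local Notation poly_series :=
  (@fps_of_poly ssrint_int__canonical__GRing_ComNzRing).

(** * Coefficientwise majorization *)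

Section Agreement.
Variable R : comNzRingType.
Implicit Types f g : fps R.

Definition fps_agree n f g := forall i, (i < n)%N -> f i = g i.

Lemma fps_agreeD n f f' g g' :
  fps_agree n f f' -> fps_agree n g g' -> fps_agree n (f + g) (f' + g').
Proof. by move=> ff' gg' i lt_in; rewrite !coef_fpsD ff' ?gg'. Qed.

Lemma fps_agreeM n f f' g g' :
  fps_agree n f f' -> fps_agree n g g' -> fps_agree n (f * g) (f' * g').
Proof.
move=> ff' gg' i lt_in; rewrite !coef_fpsM; apply: eq_bigr => j _.
by rewrite ff' ?gg'//; [exact: leq_ltn_trans (leq_subr _ _) lt_in |
  exact: leq_ltn_trans (leq_ord j) lt_in].
Qed.

Lemma fps_agreeXM n f g :
  fps_agree n f g -> fps_agree n.+1 (fpsX * f) (fpsX * g).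
Proof. by move=> fg [|i] lt_in; rewrite !coef_fpsXM ?fg. Qed.

(** [F] is an X-adic contraction, so its iterates from 0 stabilize coefficientwise. The explicit
    coefficients let sign properties of the iterates pass to the fixed point. *)
Lemma fps_fixpoint_ex (F : fps R -> fps R) :
    (forall n f g, fps_agree n f g -> fps_agree n.+1 (F f) (F g)) ->
  exists f, F f = f /\ forall n, f n = iter n.+1 F 0 n.
Proof.
move=> contrF; pose it k := iter k F 0.
have step k : fps_agree k (it k) (it k.+1).
  by elim: k => [//|k IHk]; exact: contrF IHk.
have stable n k : (n < k)%N -> it k n = it n.+1 n.
  elim: k => // k IHk; rewrite ltnS leq_eqVlt => /predU1P[->//|lt_nk].
  by rewrite -(step k n lt_nk) IHk.
pose f : fps R := fun n => it n.+1 n.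
exists f; split=> //; apply: fpsP => n.
have /contrF -> // : fps_agree n f (it n) by move=> i lt_in; rewrite [RHS]stable.
Qed.

End Agreement.

Section Majorization.
Implicit Types f g : series.

Definition fps_ge0 f := forall n, 0 <= f n.

Definition fps_maj f g := forall n, `|f n| <= g n.

Lemma fps_ge0D f g : fps_ge0 f -> fps_ge0 g -> fps_ge0 (f + g).
Proof. by move=> f0 g0 n; rewrite addr_ge0. Qed.

Lemma fps_ge0M f g : fps_ge0 f -> fps_ge0 g -> fps_ge0 (f * g).
Proof. by move=> f0 g0 n; apply: sumr_ge0 => i _; rewrite mulr_ge0. Qed.

Lemma fps_ge0_0 : fps_ge0 0. Proof. by []. Qed.

Lemma fps_ge0_1 : fps_ge0 1. Proof. by move=> n; rewrite ler0n. Qed.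

Lemma fps_ge0_X : fps_ge0 X. Proof. by move=> n; rewrite ler0n. Qed.

Lemma fps_ge0_exp f k : fps_ge0 f -> fps_ge0 (f ^+ k).
Proof.
move=> f0; elim: k => [|k IHk]; first exact: fps_ge0_1.
by rewrite exprS; exact: fps_ge0M.
Qed.

Lemma fps_ge0_nat k : fps_ge0 k%:R.
Proof.
elim: k => [|k IHk]; first exact: fps_ge0_0.
by rewrite -natr1; exact: fps_ge0D IHk fps_ge0_1.
Qed.

Lemma fps_maj_ge0 f g : fps_maj f g -> fps_ge0 g.
Proof. by move=> fg n; apply: le_trans (fg n); rewrite normr_ge0. Qed.

Lemma fps_ge0_maj f : fps_ge0 f -> fps_maj f f.
Proof. by move=> f0 n; rewrite ger0_norm. Qed.

Lemma fps_majD f f' g g' :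
  fps_maj f f' -> fps_maj g g' -> fps_maj (f + g) (f' + g').
Proof. by move=> ff' gg' n; apply: le_trans (ler_normD _ _) (lerD _ _). Qed.

Lemma fps_majN f f' : fps_maj f f' -> fps_maj (- f) f'.
Proof. by move=> ff' n; rewrite normrN. Qed.

Lemma fps_majM f f' g g' :
  fps_maj f f' -> fps_maj g g' -> fps_maj (f * g) (f' * g').
Proof.
move=> ff' gg' n; rewrite !coef_fpsM; apply: le_trans (ler_norm_sum _ _ _) _.
by apply: ler_sum => i _; rewrite normrM ler_pM.
Qed.

Lemma fps_maj_trans f g h : fps_maj f g -> fps_ge0 (h - g) -> fps_maj f h.
Proof. by move=> fg gh n; apply: le_trans (fg n) _; rewrite -subr_ge0 gh. Qed.

Lemma fps_maj_subr f g : fps_maj f g -> fps_ge0 (g - f).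
Proof. by move=> fg n; rewrite subr_ge0 (le_trans (ler_norm _))// fg. Qed.

(** Because of the factor [X], the coefficient at [n] on the right involves [f] only below [n].
    Strong induction bounds it by that of [a' + X * (b' * g)], which is at most [g n]. *)
Lemma fps_maj_fixpoint (f g a a' b b' : series) :
    f = a + X * (b * f) -> fps_maj a a' -> fps_maj b b' -> fps_ge0 g ->
  fps_ge0 (g - (a' + X * (b' * g))) -> fps_maj f g.
Proof.
move=> def_f maj_a maj_b g_ge0 step n.
elim/ltn_ind: n => n IHn; rewrite def_f.
have := step n; rewrite coef_fpsB subr_ge0; apply: le_trans.
rewrite !coef_fpsD (le_trans (ler_normD _ _))// lerD// !coef_fpsXM.
case: n IHn => [|n] IHn; first by rewrite normr0.
rewrite !coef_fpsM (le_trans (ler_norm_sum _ _ _))//; apply: ler_sum => i _.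
by rewrite normrM ler_pM// IHn// ltnS leq_subr.
Qed.

(** Multiplication by [1 - X] takes successive differences: the coefficients increase weakly from a
    nonnegative first one. *)
Definition fps_nondecr f := fps_ge0 ((1 - X) * f).

(** [1 - X ^+ k] is [1 - X] times a sum of powers of [X]. The block estimates below assume just this
    property and nonnegativity of the factors [S] and [T], which stand for powers of [X]. *)
Lemma fps_nondecr_shift f k : fps_nondecr f -> fps_ge0 (f - X ^+ k * f).
Proof.
move=> incr_f.
have -> : f - X ^+ k * f = (\sum_(i < k) X ^+ i) * ((1 - X) * f).
  have sumE : 1 - X ^+ k = (\sum_(i < k) X ^+ i) * (1 - X) :> series.
    by rewrite -[LHS]opprB subrX1; ring.
  by rewrite mulrA -sumE; ring.
apply: fps_ge0M incr_f; elim/big_ind: _ => [||i _].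
- exact: fps_ge0_0.
- exact: fps_ge0D.
- exact: fps_ge0_exp fps_ge0_X.
Qed.

End Majorization.

Ltac nonneg := repeat first [ assumption | lazymatch goal with
  | |- fps_ge0 0 => exact: fps_ge0_0
  | |- fps_ge0 1 => exact: fps_ge0_1
  | |- fps_ge0 fpsX => exact: fps_ge0_X
  | |- fps_ge0 (_%:R) => exact: fps_ge0_nat
  | |- fps_ge0 (_ + _) => apply: fps_ge0D
  | |- fps_ge0 (_ * _) => apply: fps_ge0M
  | |- fps_ge0 (_ ^+ _) => apply: fps_ge0_exp
  end ].

Ltac majorize := repeat first [ assumption | lazymatch goal with
  | |- fps_maj (_ + _) _ => apply: fps_majD
  | |- fps_maj (- _) _ => apply: fps_majN
  | |- fps_maj (_ * _) _ => apply: fps_majM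
  | |- _ => by apply: fps_ge0_maj; nonneg
  end ].

Lemma fps_ge0_eq (f g : series) : f = g -> fps_ge0 g -> fps_ge0 f.
Proof. by move->. Qed.

(* Reduces an equality modulo [l = r], with cofactor [c], to a ring identity. *)
Lemma fps_eq_mod (f g c l r : series) :
  l = r -> f - g = c * (l - r) :> series -> f = g.
Proof. by move=> -> /eqP; rewrite subrr mulr0 subr_eq0 => /eqP. Qed.

(** * The golden majorant *)

(** Each term on the right has a factor [X], so the right side is a contraction in [w]; its iterates
    from 0 have nonnegative coefficients. *)
Fact golden_series_ex :
  exists w : series, w = X + X * w + X ^+ 2 * w + X ^+ 2 * w ^+ 2 /\ fps_ge0 w.
Proof.
pose F (f : series) := X + X * f + X ^+ 2 * f + X ^+ 2 * f ^+ 2.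
have FE f : F f = X * (1 + f + X * (f + f * f)) by rewrite /F; ring.
have [|w [Fw wE]] := @fps_fixpoint_ex _ F.
  move=> n f g fg; rewrite !FE; apply: fps_agreeXM.
  by do ?[exact: fg | apply: fps_agreeD | apply: fps_agreeM].
exists w; split; first exact: esym Fw.
have itF k : fps_ge0 (iter k F 0).
  by elim: k => [|k IHk] //; rewrite iterS /F; nonneg.
by move=> n; rewrite wE; exact: itF.
Qed.

(* [W(-q)] for [y = phi + 1 = [[3, 3, 3, ...]]] *)
Definition golden_majorant : series := projT1 (cid golden_series_ex).

Local Notation w := golden_majorant.

Lemma wE : w = X + X * w + X ^+ 2 * w + X ^+ 2 * w ^+ 2.
Proof. by rewrite /golden_majorant; case: cid => ? []. Qed.

Lemma w_ge0 : fps_ge0 w.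
Proof. by rewrite /golden_majorant; case: cid => ? []. Qed.

Local Notation u := (w - X).

Lemma u_ge0 : fps_ge0 u.
Proof.
have w0 := w_ge0; apply: (@fps_ge0_eq _ (X * w + X ^+ 2 * w + X ^+ 2 * w ^+ 2)).
  by apply: (fps_eq_mod (c := 1) wE); ring.
by nonneg.
Qed.

(* In particular the coefficients of [u] at least double at each step. *)
Lemma u_double : u = X ^+ 2 + 2%:R * X * u + X ^+ 4 * w ^+ 2 * (1 + w).
Proof. by apply: (fps_eq_mod (c := 1 - X + X ^+ 2 * w) wE); ring. Qed.

Lemma uE : u = X ^+ 2 + X ^+ 3 + X ^+ 4 + (X + X ^+ 2 + 2%:R * X ^+ 3) * u
               + X ^+ 2 * u ^+ 2.
Proof. by apply: (fps_eq_mod (c := 1) wE); ring. Qed.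

Lemma u_nondecr : fps_nondecr u.
Proof.
have w0 := w_ge0; have u0 := u_ge0.
have E : (1 - X) * u = X ^+ 2 + X * u + X ^+ 4 * w ^+ 2 * (1 + w).
  by apply: (fps_eq_mod (c := 1) u_double); ring.
by rewrite /fps_nondecr E; nonneg.
Qed.

Definition ones : series := fun=> 1.

Lemma onesE : ones = 1 + X * ones.
Proof.
by apply: fpsP => -[|n]; rewrite coef_fpsD coef_fpsXM coef_fps1 ?addr0 ?add0r.
Qed.

Lemma ones_ge0 : fps_ge0 ones. Proof. by []. Qed.

Lemma ones_nondecr : fps_nondecr ones.
Proof.
have E : (1 - X) * ones = 1 by apply: (fps_eq_mod (c := 1) onesE); ring.
by rewrite /fps_nondecr E; nonneg.
Qed.

(** [X ^+ 2 * ones] solves [f = X ^+ 2 + X * f], whereas [u] is at least [X ^+ 2 + X * u] by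
    [u_double]. *)
Lemma ones_le_u : fps_ge0 (u - X ^+ 2 * ones).
Proof.
have u0 := u_ge0; have w0 := w_ge0.
apply: fps_maj_subr; apply: (@fps_maj_fixpoint _ _ (X ^+ 2) (X ^+ 2) 1 1) => //.
- by apply: (fps_eq_mod (c := X ^+ 2) onesE); ring.
- by apply: fps_ge0_maj; nonneg.
- by apply: fps_ge0_maj; nonneg.
- apply: (@fps_ge0_eq _ (X * u + X ^+ 4 * w ^+ 2 * (1 + w))); last by nonneg.
  by apply: (fps_eq_mod (c := 1) u_double); ring.
Qed.

(** * Domination of a single block *)

(* The relation between [W] and [V] for [s = X^j] and [t = X^m], cleared of
   denominators by the factor [(1 - X)^2]. *)
Definition block_step (s t W V : series) :=
  W * ((1 - X) ^+ 2 + X * (1 - s) * (1 - t * (1 + (1 - X) * V)))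
  = - ((1 - X) * s * (1 - t * (1 + (1 - X) * V))).

(** The blocks of the golden ratio: with all signs made positive and [w] in place of [W] and [V],
    the relation becomes [wE] itself, so there is no margin. *)
Lemma block_maj11 W V : block_step X X W V -> fps_maj V w -> fps_maj W w.
Proof.
move=> WV Vw; have w0 := w_ge0.
have {}WV : W = (- X + X ^+ 2 * V) + X * ((- 1 + X * V) * W).
  apply: (@fps_cancel _ ((1 - X) ^+ 2)); first by rewrite expr2 !coef0_fpsM.
  by apply: (fps_eq_mod (c := 1) WV); ring.
apply: (fps_maj_fixpoint (a' := X + X ^+ 2 * w) (b' := 1 + X * w) WV) => //.
- by majorize.
- by majorize.
- apply: (@fps_ge0_eq _ 0); last by [].
  by apply: (fps_eq_mod (c := 1) wE); ring.
Qed.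

Lemma block_maj1m T W V :
  fps_ge0 T -> (forall f, fps_nondecr f -> fps_ge0 (f - T * f)) ->
  block_step X (X ^+ 2 * T) W V -> fps_maj V w -> fps_maj W w.
Proof.
move=> T0 Tshift WV Vw; have w0 := w_ge0; have u0 := u_ge0.
pose tau := X ^+ 2 * T * (1 + V - X * V).
pose tau' := X ^+ 2 * T * (1 + w + X * w).
have {}WV : W = (- X + X * tau) + X * (tau * W).
  apply: (@fps_cancel _ (1 - X)); first by [].
  by apply: (fps_eq_mod (c := 1) WV); rewrite /tau; ring.
have tauM : fps_maj tau tau' by rewrite /tau/tau'; majorize.
have tau'0 := fps_maj_ge0 tauM.
apply: (fps_maj_fixpoint (a' := X + X * tau') (b' := tau') WV) => //.
- by majorize.
(* By [wE], [X * tau' * (1 + w)] equals [X * T * u], so the margin is [u - X * T * u]. *)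
- apply: (@fps_ge0_eq _ ((1 - X) * u + X * (u - T * u))).
    rewrite /tau'; apply: (fps_eq_mod (c := X * T * (1 + X)) wE).
    ring.
  apply: fps_ge0D; first exact: u_nondecr.
  by apply: fps_ge0M; [nonneg | exact: Tshift u_nondecr].
Qed.

Lemma block_majj1 S W V :
  fps_ge0 S -> (forall f, fps_nondecr f -> fps_ge0 (f - S * f)) ->
  block_step (X ^+ 2 * S) X W V -> fps_maj V w -> fps_maj W w.
Proof.
move=> S0 Sshift WV Vw; have w0 := w_ge0; have u0 := u_ge0.
pose a := X ^+ 2 * S * ((1 - X) * (1 - X * V)).
have {}WV : W = - a + X * ((X * V + X ^+ 2 * S * (1 - X * V)) * W).
  apply: (@fps_cancel _ (1 - X)); first by [].
  by apply: (fps_eq_mod (c := 1) WV); rewrite /a; ring.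
apply: (fps_maj_fixpoint (a' := X ^+ 2 * S * ((1 + X) * (1 + X * w)))
  (b' := X * w + X ^+ 2 * S * (1 + X * w)) WV) => //.
- by rewrite /a; majorize.
- by majorize.
(* By [wE], [h] equals [(1 + X w) (1 + X + X w)], the cofactor of [X ^+ 2 * S] in
   [a' + X * (b' * w)]. *)
- pose h := 1 + w + X * w.
  have h_nondecr : fps_nondecr h.
    apply: (@fps_ge0_eq _ (1 + (1 + X) * X ^+ 2 * (w + w ^+ 2) + X ^+ 2)).
      by rewrite /h; apply: (fps_eq_mod (c := 1 + X) wE); ring.
    by nonneg.
  have h0 := Sshift _ h_nondecr.
  apply: (@fps_ge0_eq _ (X ^+ 2 * (h - S * h) + X
                         + X * (X * w + X ^+ 2 * w ^+ 2))).
    by rewrite /h; apply: (fps_eq_mod (c := 1 + S * X ^+ 2 + X) wE); ring.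
  by nonneg.
Qed.

Lemma block_majjm S T W V :
  fps_ge0 S -> (forall f, fps_nondecr f -> fps_ge0 (f - S * f)) ->
  fps_ge0 T -> (forall f, fps_nondecr f -> fps_ge0 (f - T * f)) ->
  block_step (X ^+ 2 * S) (X ^+ 2 * T) W V -> fps_maj V w -> fps_maj W w.
Proof.
move=> S0 Sshift T0 Tshift WV Vw.
have w0 := w_ge0; have u0 := u_ge0; have o0 := ones_ge0.
have STshift f : fps_ge0 f -> fps_nondecr f -> fps_ge0 (f - S * T * f).
  move=> f0 incr_f; apply: (@fps_ge0_eq _ ((f - S * f) + S * (f - T * f))).
    by ring.
  by apply: fps_ge0D; [exact: Sshift | apply: fps_ge0M => //; exact: Tshift].
pose s := X ^+ 2 * S; pose t := X ^+ 2 * T.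
have s0 : fps_ge0 s by rewrite /s; nonneg.
have t0 : fps_ge0 t by rewrite /t; nonneg.
pose a1 : series := 1 - X ^+ 2.
pose a := - (s * a1) + s * t * (a1 + (1 - X - X ^+ 2 + X ^+ 3) * V).
pose b := - X ^+ 2 + s * (1 + X) + (1 - s) * (t * (1 + X + a1 * V)).
have {}WV : W = a + X * (b * W).
  (* Apart from terms in [s] and [t], the factor of [W] is [1 - X + X ^+ 2]; multiplying by [1 + X]
     leaves only [1 + X ^+ 3]. *)
  apply: (fps_eq_mod (c := 1 + X) WV).
  by rewrite /a /b /a1 /s /t; ring.
pose a' := s * ones + s * t * (1 + X ^+ 2 + (1 + X + X ^+ 2 + X ^+ 3) * w).
pose b' := X ^+ 2 + s * (1 + X) + (1 + s) * (t * (1 + X + (1 + X ^+ 2) * w)).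
(* Two majorants of [1 - X ^+ 2]: [1 + X ^+ 2] is sharper, but [ones] is nondecreasing, so that the
   shift hypotheses apply to it. *)
have a1_maj : fps_maj a1 ones.
  by case=> [|[|[|n]]]; rewrite /a1 coef_fpsB -[X ^+ 2]mulr1 coef_fpsXnM.
have a1_maj' : fps_maj a1 (1 + X ^+ 2) by rewrite /a1; majorize.
have maj_a : fps_maj a a'.
  apply: fps_majD; first by apply: fps_majN; majorize.
  by majorize.
have maj_b : fps_maj b b' by rewrite /b/b'; majorize.
(* The coefficient of [X] in [W] vanishes here, and the estimate needs this:
   with [w] in place of [u] it fails at [X ^+ 4]. *)
suff /fps_maj_trans : fps_maj W u.
  by apply; apply: (@fps_ge0_eq _ X); [ring | nonneg].
apply: (fps_maj_fixpoint WV maj_a maj_b) => //.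
pose r := u - X ^+ 2 - 2%:R * X * u.
have r0 : fps_ge0 r.
  apply: (@fps_ge0_eq _ (X ^+ 4 * w ^+ 2 * (1 + w))); last by nonneg.
  by rewrite /r; apply: (fps_eq_mod (c := 1) u_double); ring.
have ou0 := ones_le_u.
have o_incr := ones_nondecr; have u_incr := u_nondecr.
pose P : series := 1 + X + X ^+ 2 + X ^+ 3.
(* [G] is [(1 + X + (1 + X ^+ 2) w) u], from the last term of [b' * u], written with [w = u + X]. *)
pose G := (1 + 2%:R * X + X ^+ 3) * u + (1 + X ^+ 2) * u ^+ 2.
have G0 : fps_ge0 G by rewrite /G; nonneg.
have G_incr : fps_nondecr G.
  apply: (@fps_ge0_eq _ ((1 - X) * u
                         * (1 + 2%:R * X + X ^+ 3 + (1 + X ^+ 2) * u))).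
    by rewrite /G; ring.
  by apply: fps_ge0M => //; nonneg.
(* [rest] is the margin of the estimate at [S = T = 1], and [shifts] what is
   gained by passing to general [S] and [T]. *)
pose shifts := X ^+ 2 * (ones - S * ones)
  + X ^+ 4 * (1 + X ^+ 2) * (ones - S * T * ones)
  + X ^+ 4 * S * T * (X ^+ 3 + X ^+ 5) * ones + X ^+ 4 * P * (u - S * T * u)
  + X ^+ 3 * (1 + X) * (u - S * u) + X ^+ 3 * (G - T * G)
  + X ^+ 5 * (G - S * T * G).
have shifts0 : fps_ge0 shifts.
  have oS := Sshift _ o_incr; have uS := Sshift _ u_incr.
  have oST := STshift _ o0 o_incr; have uST := STshift _ u0 u_incr.
  have GST := STshift _ G0 G_incr; have GT := Tshift _ G_incr.
  by rewrite /shifts /P; nonneg.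
have ou : fps_ge0 (u - X * u).
  by apply: fps_ge0_eq u_incr; ring.
(* A combination, with nonnegative coefficients, of products of [X], [u] and the nonnegative series
   [r], [u - X * u] and [u - X ^+ 2 * ones]. *)
pose rest := X ^+ 3 + 2%:R * X ^+ 4 + 3%:R * (X ^+ 5 + X ^+ 6)
  + 4%:R * (X ^+ 7 + X ^+ 8)
  + (X + 3%:R * X ^+ 2 + 5%:R * X ^+ 3 + 3%:R * X ^+ 4
     + 4%:R * (X ^+ 5 + X ^+ 6)) * r
  + 6%:R * X ^+ 7 * u + X ^+ 7 * (u - X * u)
  + (X ^+ 2 + X ^+ 3 + 2%:R * (X ^+ 4 + X ^+ 5) + 4%:R * X ^+ 6) * u * r
  + (X ^+ 4 + X ^+ 5 + 2%:R * (X ^+ 6 + X ^+ 7) + 4%:R * X ^+ 8) * u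
  + 7%:R * X ^+ 7 * u ^+ 2 + 3%:R * X ^+ 4 * (u - X ^+ 2 * ones).
have rest0 : fps_ge0 rest by rewrite /rest; nonneg.
apply: (@fps_ge0_eq _ (shifts + rest)); last exact: fps_ge0D.
(* All terms in [ones] are moved to a common tail at [X ^+ 6], which is what the last summand of
   [rest] contains. *)
have onesE' : (X ^+ 2 + X ^+ 4 + X ^+ 6) * ones
    = X ^+ 2 + X ^+ 3 + 2%:R * (X ^+ 4 + X ^+ 5) + 3%:R * X ^+ 6 * ones.
  apply: (fps_eq_mod (c := X ^+ 2 + X ^+ 3 + 2%:R * (X ^+ 4 + X ^+ 5)) onesE).
  by ring.
have restE : rest = u - (X ^+ 2 + X ^+ 4 + X ^+ 6) * ones - X ^+ 4 * P * u
    - X ^+ 3 * (2%:R + X) * u - (X ^+ 3 + X ^+ 5) * G.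
  rewrite onesE'; apply: (fps_eq_mod (c := - 1) uE).
  by rewrite /rest /r /G /P; ring.
rewrite restE.
apply: (fps_eq_mod (c := X ^+ 4 * S * T * (1 + X ^+ 2) * (1 + X + X ^+ 2)) onesE).
by rewrite /shifts /a' /b' /s /t /G /P; ring.
Qed.

Lemma block_maj j m W V :
  block_step (X ^+ j.+1) (X ^+ m.+1) W V -> fps_maj V w -> fps_maj W w.
Proof.
have X0 k : fps_ge0 (X ^+ k) by nonneg.
have Xshift k f : fps_nondecr f -> fps_ge0 (f - X ^+ k * f).
  exact: fps_nondecr_shift.
case: j m => [|j] [|m].
- by rewrite !expr1; exact: block_maj11.
- by rewrite expr1 -addn2 addnC exprD; apply: block_maj1m (X0 _) (Xshift _).
- by rewrite expr1 -addn2 addnC exprD; apply: block_majj1 (X0 _) (Xshift _).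
- rewrite -(addn2 j) -(addn2 m) ![(_ + 2)%N]addnC !exprD.
  exact: block_majjm (X0 _) (Xshift _) (X0 _) (Xshift _).
Qed.

(** * Expansions of continued fractions *)

Lemma sum_ord_pad (V : nmodType) n k (F : nat -> V) :
  (forall i, (n <= i)%N -> F i = 0) -> \sum_(i < n) F i = \sum_(i < n + k) F i.
Proof.
move=> F0; rewrite big_split_ord/= [X in _ + X]big1 ?addr0// => i _.
by rewrite F0// leq_addr.
Qed.

(** Shifting by [k] turns a Laurent series without terms below [- k] into a power series. The two
    sums have different ranges, so both are padded with zeros to [size p + n.+1] terms. *)
Lemma laurent_mulp_fps (p : {poly int}) (A : int -> int) k :
    (forall n : int, n < - k%:Z -> A n = 0) -> forall n : nat,
  laurent_mulp p A (n%:Z - k%:Z)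
  = (poly_series p * (fun i : nat => A (i%:Z - k%:Z))) n.
Proof.
move=> A0 n; rewrite coef_fpsM.
pose F i := p`_i * A (n%:Z - k%:Z - i%:Z).
transitivity (\sum_(i < size p + n.+1) F i).
  by apply: sum_ord_pad => i le_i; rewrite /F nth_default// mul0r.
rewrite addnC -sum_ord_pad => [|i lt_ni]; last first.
  by rewrite /F A0 ?mulr0//; lia.
apply: eq_bigr => i _; rewrite /F; congr (_ * A _).
by have := ltn_ord i; lia.
Qed.

Definition expands (f : ratfun) (A : series) : Prop :=
  exists u v : {poly int},
    [/\ v`_0 = 1, f = tofrac u / tofrac v & poly_series v * A = poly_series u].

Definition laurent_of_fps (A : series) (n : int) : int :=
  if n is Posz i then A i else 0.

Lemma expands_laurent f A : expands f A -> laurent_expansion f (laurent_of_fps A).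
Proof.
move=> [u [v [v0 fE vA]]]; split; first by exists 0 => -[].
exists u, v; split=> //.
  by apply: contra_eq_neq v0 => ->; rewrite coef0.
have A0 (n : int) : n < - 0%:Z -> laurent_of_fps A n = 0 by case: n.
case=> n.
  have := laurent_mulp_fps v A0 n; rewrite subr0 => ->.
  have -> : (fun i : nat => laurent_of_fps A (i%:Z - 0%:Z)) = A.
    by apply: fpsP => i; rewrite subr0.
  by rewrite vA.
rewrite /laurent_mulp big1// => i _; rewrite (_ : laurent_of_fps _ _ = 0) ?mulr0//.
by apply: A0; lia.
Qed.

(** The two expansions may come from different fractions for [f]. Cross-multiplying and shifting [B]
    to a power series, one cancels [v], a unit, and [v'], which is nonzero in a domain. *)
Lemma laurent_expansion_uniq f A B :
  expands f A -> laurent_expansion f B -> B =1 laurent_of_fps A.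
Proof.
move=> [u [v [v0 fE vA]]] [[m Bm] [u' [v' [v'n0 fE' vB]]]].
pose k := `|m|%N.
have B0 (n : int) : n < - k%:Z -> B n = 0 by move=> lt_n; apply: Bm; lia.
pose B' : series := fun i : nat => B (i%:Z - k%:Z).
have v'B' : poly_series v' * B' = X ^+ k * poly_series u'.
  apply: fpsP => n; rewrite -laurent_mulp_fps// vB coef_fpsXnM.
  case: leqP => [le_kn|lt_nk]; first by rewrite subzn.
  by rewrite /laurent_of_poly; case E: (n%:Z - k%:Z) => [i|i] //; lia.
have vn0 : v != 0 by apply: contra_eq_neq v0 => ->; rewrite coef0.
have uv : u * v' = u' * v.
  apply/eqP; rewrite -tofrac_eq !rmorphM/= -eqr_div ?tofrac_eq0//.
  by rewrite -fE fE'.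
have B'E : B' = X ^+ k * A.
  apply: (@fps_cancel _ (poly_series v)); first exact: v0.
  apply/eqP; rewrite -subr_eq0; apply/eqP.
  apply: (@fps_mulf_eq0 _ (poly_series v')); last first.
    move=> v'0; move/eqP: v'n0; apply; apply/polyP => i.
    by have := congr1 (fun h : series => h i) v'0; rewrite coef0.
  have uv' : poly_series v' * poly_series u = poly_series v * poly_series u'.
    by rewrite -!rmorphM mulrC uv mulrC.
  transitivity (poly_series v * (poly_series v' * B')
    - X ^+ k * (poly_series v' * (poly_series v * A))); first by ring.
  by rewrite v'B' vA uv'; ring.
have BE n : B n = if (- k%:Z <= n) then B' `|(n + k%:Z)%R|%N else 0.
  case: ifPn => [le_n|]; last by rewrite -ltNge => /B0.
  by rewrite /B' gez0_abs ?addrK// -lerBlDr sub0r.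
move=> n; rewrite BE B'E coef_fpsXnM; case: n => n /=; last first.
  by case: ifPn => // le_kn; rewrite ifF//; clear -le_kn; lia.
rewrite ifT; last by lia.
by rewrite ifT; [congr (A _); lia | lia].
Qed.

Lemma tofrac_neq0_coef0 (v : {poly int}) : v`_0 = 1 -> tofrac v != 0.
Proof.
by move=> v0; rewrite tofrac_eq0; apply: contra_eq_neq v0 => ->; rewrite coef0.
Qed.

Lemma expandsB f g A B : expands f A -> expands g B -> expands (f - g) (A - B).
Proof.
move=> [u [v [v0 -> vA]]] [u' [v' [v'0 -> vB]]].
exists (u * v' - u' * v), (v * v'); split.
- by rewrite coef0M v0 v'0.
- rewrite rmorphB !rmorphM/= -[- (_ / _)]mulNr addf_div ?tofrac_neq0_coef0//.
  by rewrite mulNr.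
- rewrite rmorphB !rmorphM/= -vA -vB; ring.
Qed.

Lemma expandsM f g A B : expands f A -> expands g B -> expands (f * g) (A * B).
Proof.
move=> [u [v [v0 -> vA]]] [u' [v' [v'0 -> vB]]].
exists (u * u'), (v * v'); split.
- by rewrite coef0M v0 v'0.
- by rewrite !rmorphM/= mulf_div.
- rewrite !rmorphM/= -vA -vB; ring.
Qed.

Lemma expandsV f A B :
  expands f A -> A 0%N = 1 -> A * B = 1 -> expands f^-1 B.
Proof.
move=> [u [v [v0 -> vA]]] A0 AB; exists v, u; split.
- have := congr1 (fun h : series => h 0%N) vA.
  by rewrite coef0_fpsM /fps_of_poly v0 A0.
- by rewrite invf_div.
- by rewrite -vA -mulrA AB mulr1.
Qed.

Lemma expands_poly (p : {poly int}) : expands (tofrac p) (poly_series p).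
Proof. by exists p, 1; rewrite coef1 rmorph1 divr1 rmorph1 mul1r. Qed.

Lemma expands_Xn n : expands (q ^ n%:Z) (X ^+ n).
Proof.
have -> : q ^ n%:Z = tofrac ('X^n) by rewrite rmorphXn.
have -> : X ^+ n = poly_series 'X^n by rewrite rmorphXn /= fps_of_polyX.
exact: expands_poly.
Qed.

Lemma expands_qint n :
  exists2 A, expands (qint n%:Z) A & (1 - X) * A = 1 - X ^+ n.
Proof.
have [//|G [XG G0]] := @fps_inv_ex _ (1 - X : series).
exists ((1 - X ^+ n) * G); last by rewrite mulrCA XG mulr1.
have one : expands 1 1.
  by have := expands_poly 1; rewrite !rmorph1.
apply: expandsM; first exact: expandsB one (expands_Xn n).
apply: (@expandsV _ (1 - X)) => //.
by apply: expandsB one _; have := expands_Xn 1; rewrite expr1.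
Qed.

(** [W] belongs to digits that start with [j] twos and a digit [m + 3], followed by a tail whose
    series [V] is already dominated. *)
Definition reduced (W : series) : Prop :=
  exists j m V, block_step (X ^+ j.+1) (X ^+ m.+1) W V /\ fps_maj V w.

Lemma reduced_maj W : reduced W -> fps_maj W w.
Proof. by move=> [j [m [V [WV Vw]]]]; exact: block_maj WV Vw. Qed.

Definition inverse_expands (f : ratfun) (W : series) : Prop :=
  exists Y, [/\ expands f Y, Y 0%N = 1 & Y * (1 + W) = 1].

Lemma inverse_expands_ex f Y :
  expands f Y -> Y 0%N = 1 -> exists2 W, inverse_expands f W & Y * (1 + W) = 1.
Proof.
move=> fY Y0; have [V [YV _]] := fps_inv_ex Y0.
by exists (V - 1); [exists Y; split=> // |]; rewrite addrC subrK.
Qed.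

Lemma inverse_expands_qint n : exists2 W, inverse_expands (qint n.+2%:Z) W &
  (1 + W) * (1 - X ^+ n.+2) = 1 - X.
Proof.
have [Y fY YE] := expands_qint n.+2.
have Y0 : Y 0%N = 1.
  have := congr1 (fun h : series => h 0%N) YE.
  by rewrite coef0_fpsM !coef_fpsB exprS coef0_fpsM mul0r subr0 mul1r.
have [W fW YW] := inverse_expands_ex fY Y0; exists W => //.
by rewrite -YE; apply: (fps_eq_mod (c := 1 - X) YW); ring.
Qed.

(** The new inverse is that of [[n+2]_q - q^(n+1) (1 + V)]; times [1 - q], this is
    [1 - q^(n+1) (1 + (1 - q) V)]. *)
Lemma inverse_expands_step n f V : inverse_expands f V ->
  exists2 W, inverse_expands (qint n.+2%:Z - q ^ n.+1%:Z / f) W &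
  (1 + W) * (1 - X ^+ n.+1 * (1 + (1 - X) * V)) = 1 - X.
Proof.
move=> [Y' [fY' Y'0 Y'V]]; have [Z fZ ZE] := expands_qint n.+2.
have fY : expands (qint n.+2%:Z - q ^ n.+1%:Z / f) (Z - X ^+ n.+1 * (1 + V)).
  apply: expandsB fZ _; apply: expandsM (expands_Xn _) _.
  exact: expandsV fY' Y'0 Y'V.
have Y0 : (Z - X ^+ n.+1 * (1 + V)) 0%N = 1.
  have := congr1 (fun h : series => h 0%N) ZE.
  rewrite coef0_fpsM !coef_fpsB !exprS -mulrA !coef0_fpsM !mul0r !subr0 mul1r.
  by move->.
have [W fW YW] := inverse_expands_ex fY Y0; exists W => //.
have {}ZE : (1 - X) * Z = 1 - X * X ^+ n.+1 by rewrite ZE exprS.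
have {}YW : (1 - X) * ((Z - X ^+ n.+1 * (1 + V)) * (1 + W)) = 1 - X.
  by rewrite YW mulr1.
rewrite -[RHS]YW; move: (X ^+ n.+1) ZE => t ZE.
by apply: (fps_eq_mod (c := - (1 + W)) ZE); ring.
Qed.

(** The hypothesis is the relation for a digit 2 put in front. It lengthens the first block by one
    two and keeps [m] and the tail. *)
Lemma reduced_2 V W : W * (1 - X * V) = X * V -> reduced V -> reduced W.
Proof.
move=> WV [j [m [V' [VV' V'w]]]]; exists j.+1, m, V'; split=> //.
move: VV'; rewrite /block_step [X ^+ j.+2]exprS.
move: (X ^+ j.+1) (X ^+ m.+1) => s t VV'.
pose D := (1 - X) ^+ 2 + X * (1 - s) * (1 - t * (1 + (1 - X) * V')).
apply: (fps_eq_mod (c := D) WV).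
have -> : D * (W * (1 - X * V) - X * V) = W * (D - X * (V * D)) - X * (V * D).
  by ring.
rewrite VV' /D; ring.
Qed.

Lemma inverse_expands_qhcf (b : int) (s : seq int) :
    2 <= b -> all (fun c => 2 <= c) s ->
  exists2 W, inverse_expands (qhcf b s) W & reduced W.
Proof.
have block0 m W V : (1 + W) * (1 - X * X ^+ m.+1 * (1 + (1 - X) * V)) = 1 - X ->
    fps_maj V w -> reduced W.
  move=> WV Vw; exists 0%N, m, V; split=> //; rewrite /block_step expr1.
  by move: (X ^+ m.+1) WV => t WV; apply: (fps_eq_mod (c := 1 - X) WV); ring.
elim: s b => [|c s IHs] b /=.
  case: b => // -[|[|n]] // _ _.
  have [W fW WE] := inverse_expands_qint n; exists W => //.
  apply: (block0 n W 0); last by move=> i; rewrite normr0 w_ge0.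
  by rewrite mulr0 addr0 mulr1 -exprS.
case: b => // -[|[|n]] // _ /andP[c_ge2 s_ge2].
have [V fV red_V] := IHs c c_ge2 s_ge2.
have [W fW WE] := inverse_expands_step n fV; exists W.
  by rewrite (_ : n.+2%:Z - 1 = n.+1%:Z) //; lia.
(* A digit at least 3 opens a new block, whose tail series [V] is dominated by induction; a digit 2
   extends the current block. *)
case: n WE {fW} => [|n] WE; last first.
  by apply: (block0 n W V); [rewrite -exprS | exact: reduced_maj].
apply: reduced_2 red_V; apply: (@fps_cancel _ (1 - X)); first by [].
by apply: (fps_eq_mod (c := 1) WE); ring.
Qed.

Definition qhcf2_series (W : series) : series := 1 + X - X * (1 + W).

Lemma expands_qhcf2 b s W :
  inverse_expands (qhcf b s) W -> expands (qhcf 2 (b :: s)) (qhcf2_series W).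
Proof.
move=> [Y [fY Y0 YW]]; apply: expandsB.
  have [Z fZ ZE] := expands_qint 2.
  suff <- : Z = 1 + X by [].
  by apply: (@fps_cancel _ (1 - X)); [| rewrite ZE; ring].
apply: expandsM; last exact: expandsV fY Y0 YW.
by have := expands_Xn 1; rewrite expr1.
Qed.

Lemma coef_qhcf2_series W n : qhcf2_series W n.+2 = - W n.+1.
Proof.
by rewrite /qhcf2_series coef_fpsB !coef_fpsD coef_fpsXM coef_fpsD !add0r.
Qed.

Lemma qhcf2_coef_bound b s A n :
    2 <= b -> all (fun c => 2 <= c) s -> laurent_expansion (qhcf 2 (b :: s)) A ->
  `|A n.+2%:Z| <= w n.+1.
Proof.
move=> b_ge2 s_ge2 fA.
have [W fW /reduced_maj Ww] := inverse_expands_qhcf b_ge2 s_ge2.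
rewrite (laurent_expansion_uniq (expands_qhcf2 fW) fA) /=.
rewrite coef_qhcf2_series normrN.
exact: Ww.
Qed.

(** * The q-real of the golden ratio *)

Definition fps_alt (f : series) : series := fun n => (-1) ^+ n * f n.

Lemma fps_altD f g : fps_alt (f + g) = fps_alt f + fps_alt g.
Proof. by apply: fpsP => n; exact: mulrDr. Qed.

Lemma fps_altM f g : fps_alt (f * g) = fps_alt f * fps_alt g.
Proof.
apply: fpsP => n; rewrite /fps_alt !coef_fpsM mulr_sumr; apply: eq_bigr => i _.
by rewrite mulrACA -exprD subnKC ?leq_ord.
Qed.

Lemma fps_altX : fps_alt X = - X.
Proof.
by apply: fpsP => -[|[|n]]; rewrite /fps_alt coef_fpsN ?mulr0 ?oppr0 ?mulr1.
Qed.

(** The q-analogue of [y = 3 - 1/y] for [y = phi + 1]: here [[3]_q - q^2 (1 + W) = 1 + q - q^2 W],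
    with [W] the series [w] at [-q]. *)
Lemma fps_alt_w : (1 + fps_alt w) * (1 + X - X ^+ 2 * fps_alt w) = 1.
Proof.
have : fps_alt w = - X - X * fps_alt w + X ^+ 2 * fps_alt w
                   + X ^+ 2 * fps_alt w ^+ 2.
  by rewrite {1}wE !fps_altD !expr2 !fps_altM fps_altX; ring.
by move=> E; apply: (fps_eq_mod (c := 1) E); ring.
Qed.

(** Each further digit 3 multiplies the error by [X ^+ 2] and two units; one factor [X] per digit is
    enough. *)
Lemma inverse_expands_golden k :
  exists2 W, inverse_expands (qhcf 3 (nseq k 3)) W &
  exists r, W - fps_alt w = X ^+ k * r.
Proof.
elim: k => [|k [V fV [r Vr]]].
  have [W fW _] := inverse_expands_qint 1; exists W => //.
  by exists (W - fps_alt w); rewrite mul1r.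
have [W fW WE] := inverse_expands_step 1 fV; exists W => //.
exists (X * (1 + fps_alt w) * (1 + W) * r).
have {}WE : (1 + W) * (1 + X - X ^+ 2 * V) = 1.
  apply: (@fps_cancel _ (1 - X)); first by [].
  by apply: (fps_eq_mod (c := 1) WE); ring.
transitivity (X ^+ 2 * (1 + fps_alt w) * (1 + W) * (V - fps_alt w)); last first.
  by rewrite Vr (exprS X k); ring.
apply: (fps_eq_mod (c := 1 + fps_alt w) WE).
by apply: (fps_eq_mod (c := - (1 + W)) fps_alt_w); ring.
Qed.

Definition golden_laurent : int -> int :=
  laurent_of_fps (qhcf2_series (fps_alt w)).

Lemma golden_laurent_coef n : `|golden_laurent n.+2%:Z| = w n.+1.
Proof.
rewrite /golden_laurent /= coef_qhcf2_series normrN normrM normrX normrN1 expr1n.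
by rewrite mul1r ger0_norm// w_ge0.
Qed.

Lemma expands_golden k :
  exists2 Y, expands (qhcf 2 (nseq k 3)) Y &
  forall n, (n < k)%N -> Y n = qhcf2_series (fps_alt w) n.
Proof.
case: k => [|k].
  by have [Y fY _] := expands_qint 2; exists Y.
have [W fW [r Wr]] := inverse_expands_golden k.
exists (qhcf2_series W) => [|n lt_n]; first exact: expands_qhcf2.
apply/eqP; rewrite -subr_eq0 -coef_fpsB.
have -> : qhcf2_series W - qhcf2_series (fps_alt w) = X ^+ k.+1 * (- r).
  rewrite exprS mulrN -mulrA -Wr /qhcf2_series; ring.
by rewrite coef_fpsXnM leqNgt lt_n.
Qed.

(** * Hirzebruch expansions of real numbers *)

Local Notation irrational := Defs.irrational.

Section RealExpansions.
Variable R : realType.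
Implicit Types x : R.
Local Open Scope classical_set_scope.

Lemma hcf_gt a (s : seq int) :
  all (fun c => 2 <= c) s -> a%:~R - 1 < hcf R a s.
Proof.
elim: s a => [|c s IHs] a /=; first by rewrite ltrBlDr ltrDl.
move=> /andP[c_ge2 /(IHs c)]; rewrite ltrD2l ltrN2 => gt_c.
have c2 : 2 <= c%:~R :> R by rewrite (ler_int R 2).
have gt1 : 1 < hcf R c s by lra.
by rewrite invf_lt1//; apply: lt_trans gt1.
Qed.

Lemma hcf_le a (s : seq int) : all (fun c => 2 <= c) s -> hcf R a s <= a%:~R.
Proof.
case: s => [|c s] //= /andP[c_ge2 /(hcf_gt c)] gt_c.
have c2 : 2 <= c%:~R :> R by rewrite (ler_int R 2).
have gt1 : 1 < hcf R c s by lra.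
by rewrite gerBl invr_ge0; lra.
Qed.

Lemma hcf_rat a (s : seq int) : exists r : rat, hcf R a s = ratr r.
Proof.
elim: s a => [|c s IHs] a; first by exists a%:~R; rewrite /= ratr_int.
have [r rE] := IHs c; exists (a%:~R - r^-1) => /=.
by rewrite rE rmorphB /= ratr_int fmorphV.
Qed.

Lemma htail_ge2 (a : nat -> int) k :
  (forall i : nat, (0 < i)%N -> 2 <= a i) -> all (fun c => 2 <= c) (htail a k).
Proof.
move=> a_ge2; apply/allP => c /mapP[i]; rewrite mem_iota => /andP[i_gt0 _] ->.
exact: a_ge2.
Qed.

Lemma htailS a k : htail a k.+1 = a 1%N :: htail (fun i => a i.+1) k.
Proof.
rewrite /htail /=; congr cons; rewrite (iotaDl 1 1) -map_comp.
by apply: eq_map => i.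
Qed.

Lemma irrational_neq_int x (m : int) : irrational x -> x != m%:~R.
Proof.
by move=> irr_x; apply/eqP => xE; apply: (irr_x m%:~R); rewrite ratr_int.
Qed.

(** The convergents lie between the two integers, hence so does the limit; irrationality excludes
    equality. *)
Lemma infinite_hexp_bounds x a : infinite_hexp x a -> irrational x ->
  (a 0%N)%:~R - 1 < x < (a 0%N)%:~R.
Proof.
move=> [a_ge2 a_x] irr_x; have s_ge2 k := htail_ge2 k a_ge2.
have neq0 := irrational_neq_int (a 0%N) irr_x.
have := irrational_neq_int (a 0%N - 1) irr_x; rewrite intrD /= => neq1.
rewrite !lt_neqAle neq0 eq_sym neq1 /=; apply/andP; split.
  by apply: (cvgr_to_ge a_x); apply: nearW => k; rewrite ltW// hcf_gt.
by apply: (cvgr_to_le a_x); apply: nearW => k; rewrite hcf_le.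
Qed.

Lemma infinite_hexp_tail x a : infinite_hexp x a -> irrational x ->
  infinite_hexp ((a 0%N)%:~R - x)^-1 (fun i => a i.+1).
Proof.
move=> a_x irr_x; have /andP[_ lt_x] := infinite_hexp_bounds a_x irr_x.
case: a_x => a_ge2 a_x; split=> [i _|]; first exact: a_ge2.
have -> : (fun k => hcf R (a 1%N) (htail (fun i => a i.+1) k))
    = (fun k => ((a 0%N)%:~R - hcf R (a 0%N) (htail a k.+1))^-1).
  by apply/funext => k; rewrite htailS /= opprB addrC subrK invrK.
apply: cvgV; first by rewrite subr_eq0 gt_eqF.
apply: cvgB; first exact: cvg_cst.
by rewrite (cvg_shiftS (fun k => hcf R (a 0%N) (htail a k))).
Qed.

Lemma irrational_inv_sub x (m : int) : irrational x -> irrational (m%:~R - x)^-1.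
Proof.
move=> irr_x r rE; apply: (irr_x (m%:~R - r^-1)).
transitivity (m%:~R - (m%:~R - x)^-1^-1).
  by rewrite invrK opprB addrC subrK.
by rewrite rE rmorphB /= ratr_int fmorphV.
Qed.

Lemma digit_uniq x (m k : int) :
  m%:~R - 1 < x < m%:~R -> k%:~R - 1 < x < k%:~R -> m = k.
Proof.
move=> /andP[m1 m2] /andP[k1 k2].
have : (m - 1)%:~R < k%:~R :> R by rewrite intrB; apply: lt_trans k2.
have : (k - 1)%:~R < m%:~R :> R by rewrite intrB; apply: lt_trans m2.
by rewrite !ltr_int; lia.
Qed.

Lemma golden_sqr : golden R ^+ 2 = golden R + 1.
Proof.
rewrite /golden; have := @sqr_sqrtr R 5 ltac:(lra).
move: (Num.sqrt 5) => s; lra.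
Qed.

Lemma golden_bounds : 3 / 2 < golden R < 2.
Proof.
have := golden_sqr; have : 0 < golden R.
  by rewrite /golden divr_gt0// ltr_pwDl// sqrtr_ge0.
move: (golden R) => g g0 gE; apply/andP; split; nra.
Qed.

(** The denominator divides the square of the numerator and is coprime to it, so it is 1; but
    [n^2 = n + 1] has no integer solution. *)
Lemma golden_irrational : irrational (golden R).
Proof.
move=> r rE; have := golden_sqr.
rewrite rE -rmorphXn /= -(rmorph1 (@ratr R)) -rmorphD /=.
move=> /fmorph_inj rr; have d0 := denq_neq0 r.
have nd : numq r ^+ 2 = (numq r + denq r) * denq r.
  apply: (@intr_inj rat); rewrite rmorphXn rmorphM rmorphD /= !numqE.
  rewrite exprMn rr; ring.
have d1 : denq r = 1.
  have : coprimez (denq r) (numq r ^+ 2).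
    by rewrite coprimezXr// coprimezE coprime_sym coprime_num_den.
  rewrite nd /coprimez gcdzMl => /eqP; have := denq_gt0 r; lia.
move: nd; rewrite d1 mulr1 expr2; move: (numq r) => n nE.
have : n <= -1 \/ n = 0 \/ n = 1 \/ 2 <= n by lia.
by case=> [|[|[|]]] ?; nia.
Qed.

Lemma golden_inv : (2%:~R - golden R)^-1 = golden R + 1.
Proof.
have /andP[_ lt2] := golden_bounds.
apply: (mulfI (_ : 2%:~R - golden R != 0)); first by rewrite subr_eq0 gt_eqF.
rewrite divff ?subr_eq0 ?gt_eqF//; have := golden_sqr.
move: (golden R) => g gE; lra.
Qed.

(** [is_qreal] admits any expansion, so uniqueness is needed here: after the digit 2 the tail is
    [phi + 1], and removing a digit 3 gives [phi + 1] again. *)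
Lemma golden_digits a : infinite_hexp (golden R) a ->
  a 0%N = 2 /\ forall i, a i.+1 = 3.
Proof.
move=> a_phi; have irr := golden_irrational.
have /andP[lt1 lt2] := golden_bounds.
have a0 : a 0%N = 2.
  apply: digit_uniq (infinite_hexp_bounds a_phi irr) _.
  by apply/andP; split; lra.
split=> // i.
have [] : infinite_hexp (golden R + 1) (fun j => a (i + j).+1)
          /\ irrational (golden R + 1).
  elim: i => [|i [IH irr']].
    rewrite -golden_inv; split; last exact: irrational_inv_sub.
    by have := infinite_hexp_tail a_phi irr; rewrite a0.
  have a3 : a (i + 0).+1 = 3.
    apply: digit_uniq (infinite_hexp_bounds IH irr') _.
    by apply/andP; split; lra.
  split=> //; have := infinite_hexp_tail IH irr'; rewrite a3.
  have -> : 3%:~R - (golden R + 1) = 2%:~R - golden R by lra.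
  rewrite golden_inv; congr infinite_hexp; apply/funext => j.
  by rewrite addnS addSn.
move=> IH irr'; rewrite -(addn0 i).
apply: digit_uniq (infinite_hexp_bounds IH irr') _.
by apply/andP; split; lra.
Qed.

Definition golden_digit (i : nat) : int := if i is 0%N then 2 else 3.

Lemma htail_golden (a : nat -> int) k :
  (forall i, a i.+1 = 3) -> htail a k = nseq k 3.
Proof.
move=> a3; rewrite /htail; apply/(@eq_from_nth _ 0).
  by rewrite size_map size_iota size_nseq.
move=> i; rewrite size_map size_iota => lt_i.
by rewrite (nth_map 0%N) ?size_iota// nth_iota// nth_nseq lt_i a3.
Qed.

(** [phi] is fixed by [z -> 2 - 1/(z + 1)], which divides the distance to it by [(z + 1) (phi + 1)].
    Here this product exceeds 4, and 2 would suffice. *)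
Lemma hcf_golden_dist k : `|golden R - hcf R 2 (nseq k 3)| <= 1 / 2 ^+ k.
Proof.
have /andP[lt1 lt2] := golden_bounds; have gE := golden_inv.
elim: k => [|k IHk]; first by rewrite /= expr0 ler_norml; lra.
have hcf3 : hcf R 3 (nseq k 3) = hcf R 2 (nseq k 3) + 1.
  by case: k {IHk} => [|k] /=; lra.
have gt2 : 2 < hcf R 3 (nseq k 3).
  have := @hcf_gt 3 (nseq k 3); rewrite all_nseq orbT => /(_ isT).
  by apply: le_lt_trans; lra.
have -> : golden R - hcf R 2 (nseq k.+1 3)
    = (golden R - hcf R 2 (nseq k 3)) / (hcf R 3 (nseq k 3) * (golden R + 1)).
  have -> : hcf R 2 (nseq k.+1 3) = 2 - (hcf R 3 (nseq k 3))^-1 by [].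
  have gV : golden R = 2 - (golden R + 1)^-1 by rewrite -gE invrK; lra.
  have -> : hcf R 2 (nseq k 3) = hcf R 3 (nseq k 3) - 1 by rewrite hcf3 addrK.
  rewrite {1}gV; field; apply/andP; split; lra.
have D_gt4 : 4 < hcf R 3 (nseq k 3) * (golden R + 1).
  by move: gt2 lt1; move: (hcf _ _ _) (golden R) => t g; nra.
rewrite normrM normfV (gtr0_norm (lt_trans _ D_gt4))// ler_pdivrMr; last lra.
apply: le_trans IHk _; rewrite exprS invfM !mul1r.
have : 0 < (2 ^+ k)^-1 :> R by rewrite invr_gt0 exprn_gt0.
move: D_gt4; move: (hcf R 3 _ * (golden R + 1)) ((2 ^+ k)^-1) => D p.
nra.
Qed.

Lemma golden_hexp : infinite_hexp (golden R) golden_digit.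
Proof.
split=> [[|i]//|]; apply/cvgrPdist_le => e e_gt0; near=> k.
rewrite (@htail_golden golden_digit)//; apply: le_trans (hcf_golden_dist k) _.
apply/ltW; near: k; exact: near_infty_natSinv_expn_lt (PosNum e_gt0).
Unshelve. all: by end_near. Qed.

End RealExpansions.

(** * Comparison of the coefficients *)

Lemma is_qreal_coef_bound (R : realType) (x : R) A n :
  1 < x -> x < 2 -> is_qreal x A -> `|A n.+2%:Z| <= w n.+1.
Proof.
move=> gt1 lt2 [[a [s [[s_ge2 xE] fA]]] | [irr_x [a [a_x [_ [B [fB AB]]]]]]].
  have a2 : a = 2.
    have : a%:~R - 1 < 2 :> R by apply: lt_trans lt2; rewrite xE hcf_gt.
    have : 1 < a%:~R :> R by apply: lt_le_trans gt1 _; rewrite xE hcf_le.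
    by rewrite ltrBlDr -(intrD _ 2 1) (ltr_int R 1) ltr_int; lia.
  case: s s_ge2 xE fA => [|b s] /=.
    by rewrite a2 => _ xE; rewrite xE ltxx in lt2.
  by move=> /andP[b_ge2 s_ge2] _; rewrite a2; exact: qhcf2_coef_bound.
have a2 : a 0%N = 2.
  apply: digit_uniq (infinite_hexp_bounds a_x irr_x) _.
  by apply/andP; split; lra.
(* The bound holds for every convergent, so it passes to the stable coefficient. The index [K.+1]
   makes the tail of digits nonempty. *)
have [K BK] := AB n.+2%:Z; rewrite -(BK K.+1)//; have := fB K.+1.
have := htail_ge2 K.+1 a_x.1; rewrite a2 htailS /= => /andP[b_ge2 s_ge2].
exact: qhcf2_coef_bound.
Qed.

Lemma golden_is_qreal (R : realType) : is_qreal (golden R) golden_laurent.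
Proof.
right; split; first exact: golden_irrational.
exists golden_digit; split; first exact: golden_hexp.
split; first by exists 0 => -[].
have /choice[Y YE] : forall k, exists Y : series, expands (qhcf 2 (nseq k 3)) Y /\
    forall n, (n < k)%N -> Y n = qhcf2_series (fps_alt w) n.
  by move=> k; have [Y] := expands_golden k; exists Y.
exists (fun k => laurent_of_fps (Y k)); split=> [k|].
  by rewrite (@htail_golden golden_digit)//; apply: expands_laurent (YE k).1.
by case=> n; [exists n.+1 => k lt_k; exact: (YE k).2 | exists 0%N].
Qed.

Lemma is_qreal_golden_coef (R : realType) A n :
  is_qreal (golden R) A -> A n%:Z = golden_laurent n%:Z.
Proof.
move=> [[a [s [[_ xE] _]]] | [_ [a [a_phi [_ [B [fB AB]]]]]]].
  by have [r rE] := hcf_rat R a s; case: (@golden_irrational R r); rewrite xE rE.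
have [a0 a3] := golden_digits a_phi.
(* The index [K + n.+1] is past both the stabilization of [B] and the agreement given by
   [expands_golden]. *)
have [K BK] := AB n%:Z; rewrite -(BK (K + n.+1)%N) ?leq_addr//.
have := fB (K + n.+1)%N; rewrite a0 (htail_golden _ a3).
have [Y fY YE] := expands_golden (K + n.+1) => /(laurent_expansion_uniq fY) ->.
by apply: YE; rewrite leq_addl.
Qed.

Theorem theorem1p2 (R : realType) (x : R) (N : nat) :
  1 < x -> x < 2 -> (2 <= N)%N ->
  `|qreal x N%:Z| <= `|qreal (golden R) N%:Z|.
Proof.
case: N => [|[|n]] // x_gt1 x_lt2 _.
have phiP : is_qreal (golden R) (qreal (golden R)).
  by apply: (xgetPex (fun=> 0)); exists golden_laurent; exact: golden_is_qreal.
rewrite [leRHS](_ : _ = w n.+1); last first.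
  by rewrite (is_qreal_golden_coef _ phiP) golden_laurent_coef.
(* If there were no such [A], [qreal x] would be the default 0, for which the bound is the
   nonnegativity of [w]. *)
rewrite /qreal; case: xgetP => [A _ /= xA | _].
  exact: is_qreal_coef_bound xA.
by rewrite normr0 w_ge0.
Qed.
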